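(* Let $n \geq 6$ be an integer and let $s$ be an integer. Suppose that either (i) $n$ is even and $2-F_{n-2}-q_n \leq s \leq 2+F_{n-2}+p_n$, or (ii) $n$ is odd and $2-F_{n-2}-s_n \leq s \leq 2+F_{n-2}+r_n$, where (with $C_1,C_2,C_3,C_4$ and $e^i$ as in the context) $p_n = S(C_1^{-2}u^n)$ with $u^n = e^1+\sum_{i=1}^{(n-2)/2} e^{2i} + e^{n-1}$ ($n$ even); $r_n = S(C_2^{-2}v^n)$ with $v^n = e^1+\sum_{i=1}^{(n-3)/2} e^{2i} + e^{n-2}+e^{n-1}$ ($n$ odd); $q_n = -S(C_3^{-2}w^n)$ with $w^n = \sum_{i=1}^{(n-4)/2} e^{2i+1} + e^{n-2}+e^{n-1}$ ($n$ even); $s_n = -S(C_4^{-2}z^n)$ with $z^n = \sum_{i=1}^{(n-3)/2} e^{2i+1} + e^{n-1}$ ($n$ odd). Then there exists an $n\times n$ upper triangular, singular, group invertible matrix $A$ with all entries in $\{0,1\}$ such that $S(A^{\#})=s$.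
   Context: $F_m$ denotes the $m$-th Fibonacci number, $F_1=F_2=1$, $F_{m+1}=F_m+F_{m-1}$. For a real matrix or vector $X$, $S(X)$ denotes the sum of all its entries. For a real $n\times n$ matrix $A$, the group inverse $A^{\#}$ (when it exists) is the unique $n\times n$ matrix $X$ with $AXA=A$, $XAX=X$, $AX=XA$; $A$ is group invertible if such $X$ exists. Throughout, $e^1,\dots,e^{n-1}$ denote the standard basis vectors of $\mathbb{R}^{n-1}$, and matrices are specified by their columns $Ce^k$. For even $n\ge 6$, $C_1$ is the $(n-1)\times(n-1)$ matrix with $C_1e^1=e^1$, $C_1e^2=e^2$; for odd $k$ with $3\le k\le n-3$, $C_1e^k=e^1+\sum_{i=1}^{(k-1)/2}e^{2i}+e^k$; for even $k$ with $4\le k\le n-2$, $C_1e^k=\sum_{i=1}^{(k-2)/2}e^{2i+1}+e^k$; and $C_1e^{n-1}=\sum_{i=1}^{(n-4)/2}e^{2i+1}+e^{n-1}$. For odd $n\ge 7$, $C_2$ is the $(n-1)\times(n-1)$ matrix with $C_2e^1=e^1$, $C_2e^2=e^2$; for odd $k$ with $3\le k\le n-4$, $C_2e^k=e^1+\sum_{i=1}^{(k-1)/2}e^{2i}+e^k$; for even $k$ with $4\le k\le n-3$, $C_2e^k=\sum_{i=1}^{(k-2)/2}e^{2i+1}+e^k$; $C_2e^{n-2}=\sum_{i=1}^{(n-5)/2}e^{2i+1}+e^{n-2}$ and $C_2e^{n-1}=\sum_{i=1}^{(n-5)/2}e^{2i+1}+e^{n-1}$. For even $n\ge 6$, $C_3$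 is the $(n-1)\times(n-1)$ matrix with $C_3e^1=e^1$, $C_3e^2=e^2$; for odd $k$ with $3\le k\le n-3$, $C_3e^k=e^1+\sum_{i=1}^{(k-1)/2}e^{2i}+e^k$; for even $k$ with $4\le k\le n-4$, $C_3e^k=\sum_{i=1}^{(k-2)/2}e^{2i+1}+e^k$; $C_3e^{n-2}=e^1+\sum_{i=1}^{(n-4)/2}e^{2i}+e^{n-2}$ and $C_3e^{n-1}=e^1+\sum_{i=1}^{(n-4)/2}e^{2i}+e^{n-1}$. For odd $n\ge 7$, $C_4$ is the $(n-1)\times(n-1)$ matrix with $C_4e^1=e^1$, $C_4e^2=e^2$; for odd $k$ with $3\le k\le n-2$, $C_4e^k=e^1+\sum_{i=1}^{(k-1)/2}e^{2i}+e^k$; for even $k$ with $4\le k\le n-3$, $C_4e^k=\sum_{i=1}^{(k-2)/2}e^{2i+1}+e^k$; and $C_4e^{n-1}=e^1+\sum_{i=1}^{(n-3)/2}e^{2i}+e^{n-1}$. All four matrices are upper triangular with entries in $\{0,1\}$ and ones on the diagonal, hence invertible. *)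

(* Defs.v *)
From mathcomp Require Export all_boot all_order all_algebra.
From mathcomp Require Export reals.

Set Implicit Arguments.
Unset Strict Implicit.
Unset Printing Implicit Defensive.

Import GRing.Theory.
Local Open Scope ring_scope.

Fixpoint fib (m : nat) : nat :=
  match m with
  | 0 => 0
  | 1 => 1
  | (m'.+1 as m1).+1 => fib m1 + fib m'
  end%N.

Definition entry_sum (R : realType) (m p : nat) (X : 'M[R]_(m, p)) : R :=
  \sum_(i < m) \sum_(j < p) X i j.

Definition is_group_inverse (R : realType) (n : nat) (A X : 'M[R]_n) : Prop :=
  [/\ A *m X *m A = A, X *m A *m X = X & A *m X = X *m A].

Lemma is_group_inverse_unique (R : realType) (n : nat) (A X Y : 'M[R]_n) :
  is_group_inverse A X -> is_group_inverse A Y -> X = Y.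
Proof.
move=> [AXA XAX AX] [AYA YAY AY].
have E : A *m X = A *m Y.
  rewrite -{1}AYA -(mulmxA (A *m Y) A X) AX AY -(mulmxA Y A (X *m A)).
  by rewrite (mulmxA A X A) AXA.
by rewrite -XAX -mulmxA E mulmxA -AX E AY YAY.
Qed.

(* [std_basis d k] is e^k in R^d with the 1-based index k; it is the zero
   vector when k is not in {1, ..., d}. *)
Definition std_basis (R : realType) (d k : nat) : 'cV[R]_d :=
  \col_(i < d) (i.+1 == k)%:R.

(* e^2 + e^4 + ... + e^(2a) *)
Definition even_sum (R : realType) (d a : nat) : 'cV[R]_d :=
  \sum_(1 <= i < a.+1) std_basis R d (2 * i)%N.

(* e^3 + e^5 + ... + e^(2a+1): e^1 is not included *)
Definition odd_sum (R : realType) (d a : nat) : 'cV[R]_d :=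
  \sum_(1 <= i < a.+1) std_basis R d (2 * i + 1)%N.

(* The matrix whose k-th column (k = 1, ..., d) is [c k]. *)
Definition mx_of_cols (R : realType) (d : nat) (c : nat -> 'cV[R]_d) : 'M[R]_d :=
  \matrix_(i < d, j < d) c j.+1 i 0.

(* The columns shared by all four families: the generic odd and even k. *)
Definition generic_col (R : realType) (d k : nat) : 'cV[R]_d :=
  if odd k then std_basis R d 1 + even_sum R d ((k - 1) %/ 2) + std_basis R d k
  else odd_sum R d ((k - 2) %/ 2) + std_basis R d k.

Definition C1 (R : realType) (n : nat) : 'M[R]_n.-1 :=
  mx_of_cols (fun k : nat =>
    if (k <= 2)%N then std_basis R n.-1 k
    else if k == n.-1 then odd_sum R n.-1 ((n - 4) %/ 2) + std_basis R n.-1 k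
    else generic_col R n.-1 k).

Definition C2 (R : realType) (n : nat) : 'M[R]_n.-1 :=
  mx_of_cols (fun k : nat =>
    if (k <= 2)%N then std_basis R n.-1 k
    else if (k == n.-2) || (k == n.-1) then
      odd_sum R n.-1 ((n - 5) %/ 2) + std_basis R n.-1 k
    else generic_col R n.-1 k).

Definition C3 (R : realType) (n : nat) : 'M[R]_n.-1 :=
  mx_of_cols (fun k : nat =>
    if (k <= 2)%N then std_basis R n.-1 k
    else if (k == n.-2) || (k == n.-1) then
      std_basis R n.-1 1 + even_sum R n.-1 ((n - 4) %/ 2) + std_basis R n.-1 k
    else generic_col R n.-1 k).

Definition C4 (R : realType) (n : nat) : 'M[R]_n.-1 :=
  mx_of_cols (fun k : nat =>
    if (k <= 2)%N then std_basis R n.-1 k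
    else if k == n.-1 then
      std_basis R n.-1 1 + even_sum R n.-1 ((n - 3) %/ 2) + std_basis R n.-1 k
    else generic_col R n.-1 k).

Definition u_vec (R : realType) (n : nat) : 'cV[R]_n.-1 :=
  std_basis R n.-1 1 + even_sum R n.-1 ((n - 2) %/ 2) + std_basis R n.-1 n.-1.

Definition v_vec (R : realType) (n : nat) : 'cV[R]_n.-1 :=
  std_basis R n.-1 1 + even_sum R n.-1 ((n - 3) %/ 2)
  + std_basis R n.-1 n.-2 + std_basis R n.-1 n.-1.

Definition w_vec (R : realType) (n : nat) : 'cV[R]_n.-1 :=
  odd_sum R n.-1 ((n - 4) %/ 2) + std_basis R n.-1 n.-2 + std_basis R n.-1 n.-1.

Definition z_vec (R : realType) (n : nat) : 'cV[R]_n.-1 :=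
  odd_sum R n.-1 ((n - 3) %/ 2) + std_basis R n.-1 n.-1.

(* C^(-2) x *)
Definition inv_sq_mul (R : realType) (d : nat) (C : 'M[R]_d) (x : 'cV[R]_d) :
    'cV[R]_d :=
  invmx C *m invmx C *m x.

Definition p_val (R : realType) (n : nat) : R :=
  entry_sum (inv_sq_mul (C1 R n) (u_vec R n)).

Definition r_val (R : realType) (n : nat) : R :=
  entry_sum (inv_sq_mul (C2 R n) (v_vec R n)).

Definition q_val (R : realType) (n : nat) : R :=
  - entry_sum (inv_sq_mul (C3 R n) (w_vec R n)).

Definition s_val (R : realType) (n : nat) : R :=
  - entry_sum (inv_sq_mul (C4 R n) (z_vec R n)).

(* Main.v *)
(** For an invertible upper triangular 0/1 matrix C of order n - 1 and a 0/1
    vector x, the bordered matrix A = [[C, x], [0, 0]] has group inverse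
    [[C^-1, C^-2 x], [0, 0]], so S(A^#) = S(C^-1) + z.x, where z is the row of
    column sums of C^-2. For each of the four families, S(C^-1) = 2 +/- F_(n-2)
    and the numbers |z_k| form a complete sequence (each is at most one more
    than the sum of the previous ones). Hence, as x varies, z.x takes every
    integer value between its extremes. The two intervals obtained for a given
    n, one around 2 + F_(n-2) and the other around 2 - F_(n-2), leave no gap
    because |z_1| + ... + |z_(n-3)| + 1 >= 2 F_(n-2). *)

Require Import Defs.
From mathcomp Require Import zify ring.

Import Order.TTheory GRing.Theory Num.Theory.
Local Open Scope ring_scope.

Set Implicit Arguments.
Unset Strict Implicit.
Unset Printing Implicit Defensive.

(** * Subset sums of integer sequences *)

(** Induction on [d]: the interval reached so far has length [hi - lo], the sum of the [|z i|], so
    its translate by [z d] overlaps or abuts it and no integer is skipped. *)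
Lemma subset_sum_interval (z : nat -> int) (d : nat) (t : int) :
  (forall k, `|z k| <= 1 + \sum_(i < k) `|z i|) ->
  \sum_(i < d) Num.min (z i) 0 <= t <= \sum_(i < d) Num.max (z i) 0 ->
  exists x : nat -> bool, \sum_(i < d) (x i)%:R * z i = t.
Proof.
move=> zP; elim: d t => [|d IH] t.
  by rewrite !big_ord0 -eq_le => /eqP <-; exists xpred0; rewrite big_ord0.
set lo := \sum_(i < d) Num.min (z i) 0; set hi := \sum_(i < d) Num.max (z i) 0.
have len : \sum_(i < d) `|z i| = hi - lo.
  rewrite /hi /lo -sumrB; apply: eq_bigr => i _; lia.
have := zP d; rewrite len !big_ord_recr /= -/lo -/hi => zd tP.
suff [b bP] : exists b : bool, lo <= t - b%:R * z d <= hi.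
  have [x xP] := IH _ bP.
  exists (fun i => if i == d then b else x i).
  rewrite big_ord_recr /= eqxx (eq_bigr (fun i : 'I_d => (x i)%:R * z i)).
    by rewrite xP subrK.
  by move=> i _; rewrite (ltn_eqF (ltn_ord i)).
case: (boolP (lo <= t <= hi)) => ht; [exists false | exists true] => /=; lia.
Qed.

(** Any selection lies between the extremes, so explicit border vectors can serve as endpoints
    without a proof that they are extremal. *)
Lemma subset_sum_between (z : nat -> int) (d : nat) (x0 x1 : nat -> bool)
    (t : int) :
  (forall k, `|z k| <= 1 + \sum_(i < k) `|z i|) ->
  \sum_(i < d) (x0 i)%:R * z i <= t <= \sum_(i < d) (x1 i)%:R * z i ->
  exists x : nat -> bool, \sum_(i < d) (x i)%:R * z i = t.
Proof.
move=> zP /andP[t0 t1]; apply: subset_sum_interval => //; apply/andP; split.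
  by apply: le_trans t0; apply: ler_sum => i _; case: (x0 i) => /=; lia.
by apply: (le_trans t1); apply: ler_sum => i _; case: (x1 i) => /=; lia.
Qed.

(** * Bordered matrices and their group inverses *)

Lemma entry_sumE (R : realType) m p (X : 'M[R]_(m, p)) :
  entry_sum X = ((const_mx 1 : 'rV_m) *m X *m (const_mx 1 : 'cV_p)) 0 0.
Proof.
rewrite /entry_sum exchange_big mxE; apply: eq_bigr => j _.
by rewrite !mxE mulr1; apply: eq_bigr => i _; rewrite !mxE mul1r.
Qed.

Lemma bordered_group_inverse (R : realType) d (C : 'M[R]_d) (x : 'cV_d) :
  C \in unitmx ->
  is_group_inverse (block_mx C x 0 0 : 'M_(d + 1))
    (block_mx (invmx C) (inv_sq_mul C x) 0 0).
Proof.
move=> Cu; rewrite /inv_sq_mul; split; rewrite !mulmx_block;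
  rewrite !(mulmx0, mul0mx, addr0) ?(mulmxA, mulmxV, mulVmx, mul1mx) //.
Qed.

Lemma entry_sum_block (R : realType) d (C : 'M[R]_d) (x : 'cV_d) :
  entry_sum (block_mx C x 0 0 : 'M_(d + 1)) = entry_sum C + entry_sum x.
Proof.
rewrite /entry_sum big_split_ord /= [X in _ + X]big1 ?addr0 => [|i _].
  rewrite -big_split /=; apply: eq_bigr => i _; rewrite big_split_ord /=.
  by congr (_ + _); apply: eq_bigr => j _; rewrite (block_mxEul, block_mxEur).
rewrite big_split_ord /= !big1 ?addr0 // => j _.
  by rewrite block_mxEdr mxE.
by rewrite block_mxEdl mxE.
Qed.

Lemma det_upper_trig (R : realType) d (C : 'M[R]_d) :
  is_trig_mx C^T -> \det C = \prod_i C i i.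
Proof.
by move=> /det_trig; rewrite det_tr => ->; apply: eq_bigr => i _; rewrite mxE.
Qed.

Lemma bordered_realizes (R : realType) d n (C : 'M[R]_d) (x : 'cV_d) :
  n = (d + 1)%N -> C \in unitmx -> is_trig_mx C^T ->
  (forall i j, C i j = 0 \/ C i j = 1) -> (forall i, x i 0 = 0 \/ x i 0 = 1) ->
  exists A : 'M[R]_n,
    [/\ is_trig_mx A^T, A \notin unitmx, forall i j, A i j = 0 \/ A i j = 1
      & exists2 X : 'M[R]_n, is_group_inverse A X
        & entry_sum X = entry_sum (invmx C) + entry_sum (inv_sq_mul C x)].
Proof.
move=> -> Cu Ct C01 x01; pose A : 'M_(d + 1) := block_mx C x 0 0.
have At : is_trig_mx A^T.
  by rewrite /A tr_block_mx is_trig_block_mx // !trmx0 eqxx Ct mx0_is_trig.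
exists A; split => //.
(* The last diagonal entry is 0, hence so is the determinant. *)
- rewrite unitmxE (det_upper_trig At) (bigD1 (rshift d ord0)) //=.
  by rewrite block_mxEdr mxE mul0r unitr0.
- move=> i j; rewrite -[i]splitK -[j]splitK.
  case: (split i) => i'; case: (split j) => j' /=.
  + by rewrite block_mxEul.
  + by rewrite block_mxEur (ord1 j').
  + by rewrite block_mxEdl mxE; left.
  + by rewrite block_mxEdr mxE; left.
exists (block_mx (invmx C) (inv_sq_mul C x) 0 0).
  exact: bordered_group_inverse.
exact: entry_sum_block.
Qed.

(** [Y] is the row of column sums of the inverse, certified by a product with [C] instead of
    computing [invmx C]. *)
Lemma entry_sum_invmx (R : realType) d (C : 'M[R]_d) (Y : 'rV_d) :
  C \in unitmx -> Y *m C = const_mx 1 ->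
  entry_sum (invmx C) = \sum_i Y 0 i.
Proof.
move=> Cu YC; rewrite entry_sumE -YC mulmxK // mxE.
by apply: eq_bigr => i _; rewrite mxE mulr1.
Qed.

Lemma entry_sum_inv_sq_mul (R : realType) d (C : 'M[R]_d) (Y Z : 'rV_d)
    (x : 'cV_d) :
  C \in unitmx -> Y *m C = const_mx 1 -> Z *m C = Y ->
  entry_sum (inv_sq_mul C x) = \sum_i x i 0 * Z 0 i.
Proof.
move=> Cu YC ZC; rewrite entry_sumE -YC -ZC /inv_sq_mul !mulmxA !mulmxK //.
rewrite mxE big_ord1 [const_mx _ _ _]mxE mulr1 mxE.
by apply: eq_bigr => i _; rewrite mulrC.
Qed.

(** * A common form for the four matrix families *)

(* The strictly upper triangular support of the generic column k, with 1-based
   indices; it has to be cut off at i < k. *)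
Definition col_supp (k i : nat) : bool :=
  if odd k then (i == 1%N) || ~~ odd i else (2 < i)%N && odd i.

(* The columns k > m repeat the strictly upper triangular part of column m.
   With d = n - 1, the matrices C_1, ..., C_4 are the cases m = n - 2 and
   m = n - 3. *)
Definition fib_mx (R : realType) (d m : nat) : 'M[R]_d :=
  \matrix_(i, j)
    ((i == j) || (col_supp (minn j.+1 m) i.+1 && (i.+1 < minn j.+1 m)%N))%:R.

Lemma fib_mx_trig (R : realType) d m : is_trig_mx (fib_mx R d m)^T.
Proof.
apply/is_trig_mxP => i j ij; rewrite !mxE.
have -> : (j == i) = false by rewrite -val_eqE gtn_eqF.
by rewrite [(_ < _)%N](_ : _ = false) ?andbF //; lia.
Qed.

Lemma fib_mx_unit (R : realType) d m : fib_mx R d m \in unitmx.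
Proof.
rewrite unitmxE det_upper_trig ?fib_mx_trig // big1 ?unitr1 // => i _.
by rewrite mxE eqxx.
Qed.

(** For [k >= 2] the support of column [k + 2] is that of column [k] plus the row [k + 1], so
    differencing in steps of two leaves a short recurrence. Column 3 also gains row 1 and is checked
    apart. *)
Lemma col_supp_sum (f g : nat -> int) :
  f 1%N = g 1%N -> f 2%N = g 2%N -> f 3%N + f 1%N + f 2%N = g 3%N ->
  (forall k, (2 <= k)%N -> g k.+2 - g k = f k.+2 - f k + f k.+1) ->
  forall k, (1 <= k)%N -> f k + \sum_(1 <= i < k | col_supp k i) f i = g k.
Proof.
move=> f1 f2 f3 fS.
have H2 : f 2%N + \sum_(1 <= i < 2 | col_supp 2 i) f i = g 2%N.
  by rewrite unlock /= addr0.
have H3 : f 3%N + \sum_(1 <= i < 3 | col_supp 3 i) f i = g 3%N.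
  by rewrite -f3 unlock /= addr0 addrA.
suff H : forall k, (2 <= k)%N ->
    f k + \sum_(1 <= i < k | col_supp k i) f i = g k /\
    f k.+1 + \sum_(1 <= i < k.+1 | col_supp k.+1 i) f i = g k.+1.
  case=> [|[|k]] // _; first by rewrite big_geq // addr0.
  by case: (H k.+2).
elim=> [|[|[|k]] IH] // _.
have [{}IH ?] := IH isT; split => //.
have := fS k.+2 isT; rewrite -IH.
have -> : \sum_(1 <= i < k.+4 | col_supp k.+4 i) f i =
   f k.+3 + \sum_(1 <= i < k.+2 | col_supp k.+2 i) f i.
  rewrite big_mkcond big_nat_recr // big_nat_recr //= -big_mkcond /=.
  rewrite addrC; congr (_ + _).
    by rewrite /col_supp /= !negbK; case: odd.
  rewrite [X in _ + X](_ : _ = 0) ?addr0; last first.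
    by rewrite /col_supp /= !negbK; case: odd; rewrite ?andbF.
  by apply: eq_bigl => i; rewrite /col_supp /= !negbK.
lia.
Qed.

(** A column beyond [m] has the off-diagonal part of column [m], and its diagonal picks up [f m]
    since [f] is frozen there; it thus yields [g m] again. *)
Lemma row_mul_fib_mx (R : realType) d m (f g : nat -> int) :
  (0 < m)%N ->
  (forall k, (1 <= k)%N -> f k + \sum_(1 <= i < k | col_supp k i) f i = g k) ->
  (\row_i (f (minn i.+1 m))%:~R) *m fib_mx R d m = \row_j (g (minn j.+1 m))%:~R.
Proof.
move=> m0 fg; apply/rowP => j; rewrite !mxE.
set k := minn j.+1 m; have k0 : (1 <= k)%N by rewrite /k; lia.
have kj : (k <= j.+1)%N by rewrite /k; lia.
rewrite -fg // (big_nat_widen _ _ d.+1); last by have := ltn_ord j; lia.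
rewrite rmorphD /= rmorph_sum /= big_add1 /= big_mkord.
rewrite [in RHS]big_mkcond (bigD1 j) //= [in RHS](bigD1 j) //=.
rewrite !mxE eqxx mulr1 ltnNge kj andbF add0r; congr (_ + _).
apply: eq_bigr => i /negbTE ij; rewrite !mxE ij /= -/k.
have [/andP[_ ik]|_] := ifPn; last by rewrite mulr0.
by rewrite mulr1; congr (f _)%:~R; rewrite /k in ik; lia.
Qed.

(** * Column sums of the inverse and of its square *)

(* The absolute values of the column sums of (fib_mx d m)^-2. *)
Fixpoint fib2 (k : nat) : nat :=
  match k with
  | 0 => 0
  | 1 => 1
  | (k'.+1 as k1).+1 => fib2 k1 + fib2 k' + fib k'
  end%N.

Local Arguments fib : simpl never.
Local Arguments fib2 : simpl never.

Lemma fib2SS k : fib2 k.+2 = (fib2 k.+1 + fib2 k + fib k)%N.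
Proof. by []. Qed.

Lemma fibSS k : fib k.+2 = (fib k.+1 + fib k)%N.
Proof. by []. Qed.

(* The column sums of (fib_mx d m)^-1 for k <= m (k is 1-based). *)
Definition inv_colsum (k : nat) : int :=
  if k == 1%N then 1 else (-1) ^+ k * (fib k.-1)%:Z.

(* The column sums of (fib_mx d m)^-2 for k <= m (k is 1-based). *)
Definition inv_sq_colsum (k : nat) : int :=
  if k == 1%N then 1 else (-1) ^+ k * (fib2 k)%:Z.

(** For constant [g] the recurrence is f(k+2) = f(k) - f(k+1): Fibonacci with alternating signs. *)
Lemma inv_colsumP k :
  (1 <= k)%N ->
  inv_colsum k + \sum_(1 <= i < k | col_supp k i) inv_colsum i = 1.
Proof.
apply: (col_supp_sum (g := fun=> 1)) => // -[|[|{}k]] // _.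
rewrite /inv_colsum !exprS /= [fib k.+3]fibSS; ring.
Qed.

Lemma inv_sq_colsumP k :
  (1 <= k)%N ->
  inv_sq_colsum k + \sum_(1 <= i < k | col_supp k i) inv_sq_colsum i
    = inv_colsum k.
Proof.
apply: (col_supp_sum (g := inv_colsum)) => // -[|[|{}k]] // _.
rewrite /inv_colsum /inv_sq_colsum !exprS /=.
rewrite [fib2 k.+4]fib2SS [fib k.+3]fibSS; ring.
Qed.

Lemma entry_sum_inv_fib_mx (R : realType) d m :
  (0 < m)%N ->
  entry_sum (invmx (fib_mx R d m))
    = (\sum_(i < d) inv_colsum (minn i.+1 m))%:~R.
Proof.
move=> m0; rewrite (entry_sum_invmx (fib_mx_unit R d m)
  (Y := \row_i (inv_colsum (minn i.+1 m))%:~R)).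
  by rewrite rmorph_sum; apply: eq_bigr => i _; rewrite mxE.
rewrite (row_mul_fib_mx _ _ m0 inv_colsumP).
by apply/rowP => j; rewrite !mxE.
Qed.

Lemma entry_sum_inv_sq_fib_mx (R : realType) d m (x : nat -> bool) :
  (0 < m)%N ->
  entry_sum (inv_sq_mul (fib_mx R d m) (\col_i (x i)%:R))
    = (\sum_(i < d) (x i)%:R * inv_sq_colsum (minn i.+1 m))%:~R.
Proof.
move=> m0; rewrite (entry_sum_inv_sq_mul _ (fib_mx_unit R d m)
  (Y := \row_i (inv_colsum (minn i.+1 m))%:~R)
  (Z := \row_i (inv_sq_colsum (minn i.+1 m))%:~R)).
- rewrite rmorph_sum; apply: eq_bigr => i _; rewrite !mxE rmorphM /=.
  by case: (x i).
- rewrite (row_mul_fib_mx _ _ m0 inv_colsumP).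
  by apply/rowP => j; rewrite !mxE.
- exact: (row_mul_fib_mx _ _ m0 inv_sq_colsumP).
Qed.

(** * Entries of the given matrices and vectors, with 0-based indices *)

Lemma even_sumE (R : realType) d a i :
  even_sum R d a i 0 = (odd i && (i < 2 * a)%N)%:R.
Proof.
elim: a => [|a IH]; rewrite /even_sum.
  by rewrite big_geq // mxE muln0 ltn0 andbF.
rewrite big_nat_recr //= -/(even_sum R d a) mxE IH mxE -natrD.
by congr _%:R; lia.
Qed.

Lemma odd_sumE (R : realType) d a i :
  odd_sum R d a i 0 = (~~ odd i && (0 < i <= 2 * a)%N)%:R.
Proof.
elim: a => [|a IH]; rewrite /odd_sum.
  by rewrite big_geq // mxE; case: andP => // -[_]; lia.
rewrite big_nat_recr //= -/(odd_sum R d a) mxE IH mxE -natrD.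
by congr _%:R; lia.
Qed.

(** [l = k] is a generic column; [l > k] is a final column repeating the support of column [k]. *)
Lemma odd_col (R : realType) d k l (i : 'I_d) :
  odd k -> (2 < k <= l)%N ->
  (std_basis R d 1 + even_sum R d ((k - 1) %/ 2) + std_basis R d l) i 0
    = ((i.+1 == l) || (col_supp k i.+1 && (i.+1 < k)%N))%:R.
Proof.
move=> ok kl; rewrite /col_supp ok !(mxE, even_sumE) -!natrD.
by case: i => i /= _; congr _%:R; lia.
Qed.

Lemma even_col (R : realType) d k l (i : 'I_d) :
  ~~ odd k -> (2 < k <= l)%N ->
  (odd_sum R d ((k - 2) %/ 2) + std_basis R d l) i 0
    = ((i.+1 == l) || (col_supp k i.+1 && (i.+1 < k)%N))%:R.
Proof.
move=> ok kl; rewrite /col_supp (negbTE ok) !(mxE, odd_sumE) -!natrD.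
by case: i => i /= _; congr _%:R; lia.
Qed.

Lemma generic_colE (R : realType) d k (i : 'I_d) :
  (2 < k)%N ->
  generic_col R d k i 0
    = ((i.+1 == k) || (col_supp k i.+1 && (i.+1 < k)%N))%:R.
Proof.
move=> k2; rewrite /generic_col; case: ifPn => ok.
  by rewrite odd_col ?k2 ?leqnn.
by rewrite even_col ?k2 ?leqnn.
Qed.

Lemma mx_of_cols_fib_mx (R : realType) d m (c : nat -> 'cV[R]_d) :
  (2 < m)%N ->
  (forall k, (m < k <= d)%N -> forall i, c k i 0
     = ((i.+1 == k) || (col_supp m i.+1 && (i.+1 < m)%N))%:R) ->
  (forall k, (2 < k <= m)%N -> c k = generic_col R d k) ->
  mx_of_cols (fun k => if (k <= 2)%N then std_basis R d k else c k)
    = fib_mx R d m.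
Proof.
move=> m2 clast cgen; apply/matrixP => i j; rewrite !mxE.
rewrite (_ : (i == j) = (i.+1 == j.+1)) //.
have [j2|j2] := leqP j.+1 2.
  rewrite mxE (minn_idPl _); last by lia.
  case: (j : nat) j2 => [|[|]] // _.
    by rewrite andbF orbF.
  by case: (i : nat) => // k; rewrite andbF orbF.
have [jm|jm] := leqP j.+1 m.
  by rewrite cgen ?j2 // generic_colE.
by rewrite clast // jm ltn_ord.
Qed.

Lemma C1_fib_mx (R : realType) n :
  (6 <= n)%N -> ~~ odd n -> C1 R n = fib_mx R n.-1 (n - 2).
Proof.
move=> n6 on; apply: mx_of_cols_fib_mx; first by lia.
  move=> k kP i; rewrite ifT; last by lia.
  by rewrite (_ : n - 4 = n - 2 - 2)%N ?even_col //; lia.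
by move=> k kP; rewrite ifF //; lia.
Qed.

Lemma C2_fib_mx (R : realType) n :
  (6 <= n)%N -> odd n -> C2 R n = fib_mx R n.-1 (n - 3).
Proof.
move=> n6 on; apply: mx_of_cols_fib_mx; first by lia.
  move=> k kP i; rewrite ifT; last by lia.
  by rewrite (_ : n - 5 = n - 3 - 2)%N ?even_col //; lia.
by move=> k kP; rewrite ifF //; lia.
Qed.

Lemma C3_fib_mx (R : realType) n :
  (6 <= n)%N -> ~~ odd n -> C3 R n = fib_mx R n.-1 (n - 3).
Proof.
move=> n6 on; apply: mx_of_cols_fib_mx; first by lia.
  move=> k kP i; rewrite ifT; last by lia.
  by rewrite (_ : n - 4 = n - 3 - 1)%N ?odd_col //; lia.
by move=> k kP; rewrite ifF //; lia.
Qed.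

Lemma C4_fib_mx (R : realType) n :
  (6 <= n)%N -> odd n -> C4 R n = fib_mx R n.-1 (n - 2).
Proof.
move=> n6 on; apply: mx_of_cols_fib_mx; first by lia.
  move=> k kP i; rewrite ifT; last by lia.
  by rewrite (_ : n - 3 = n - 2 - 1)%N ?odd_col //; lia.
by move=> k kP; rewrite ifF //; lia.
Qed.

Lemma u_vecE (R : realType) n : (6 <= n)%N -> ~~ odd n ->
  u_vec R n = \col_i [|| i == 0 :> nat, odd i | i == n - 2 :> nat]%N%:R.
Proof.
move=> n6 on; apply/colP => i; have := ltn_ord i.
rewrite !(mxE, even_sumE) -!natrD => ?; congr _%:R; lia.
Qed.

Lemma v_vecE (R : realType) n : (6 <= n)%N -> odd n ->
  v_vec R n = \col_i [|| i == 0 :> nat, odd i | n - 3 <= i]%N%:R.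
Proof.
move=> n6 on; apply/colP => i; have := ltn_ord i.
rewrite !(mxE, even_sumE) -!natrD => ?; congr _%:R; lia.
Qed.

Lemma w_vecE (R : realType) n : (6 <= n)%N -> ~~ odd n ->
  w_vec R n = \col_i ((0 < i) && ~~ odd i || (n - 3 <= i))%N%:R.
Proof.
move=> n6 on; apply/colP => i; have := ltn_ord i.
rewrite !(mxE, odd_sumE) -!natrD => ?; congr _%:R; lia.
Qed.

Lemma z_vecE (R : realType) n : (6 <= n)%N -> odd n ->
  z_vec R n = \col_i ((0 < i) && ~~ odd i || (i == n - 2 :> nat))%N%:R.
Proof.
move=> n6 on; apply/colP => i; have := ltn_ord i.
rewrite !(mxE, odd_sumE) -!natrD => ?; congr _%:R; lia.
Qed.

(** * The entry sum of the inverse, and growth estimates *)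

Lemma sum_inv_colsum k :
  \sum_(i < k.+2) inv_colsum i.+1 = 2 + (-1) ^+ k * (fib k)%:Z.
Proof.
elim: k => [|k IH]; first by rewrite !big_ord_recr big_ord0.
rewrite big_ord_recr /= IH /inv_colsum /= fibSS !exprS; ring.
Qed.

(** With m = k + 2, the one or two repeated columns turn F_k into F_k + F_(k+1) = F_(k+2) or F_k + 2
    F_(k+1) = F_(k+3), which is F_(n-2) either way. *)
Lemma sum_inv_colsum_minn n m :
  (6 <= n)%N -> (n - 3 <= m <= n - 2)%N ->
  \sum_(i < n.-1) inv_colsum (minn i.+1 m) = 2 + (-1) ^+ m * (fib (n - 2))%:Z.
Proof.
move=> n6 mP; have [k mE] : exists k, m = k.+2 by exists m.-2; lia.
have tail i : inv_colsum (minn (k.+2 + i).+1 m) = (-1) ^+ k * (fib k.+1)%:Z.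
  rewrite (_ : minn _ _ = k.+2); last by lia.
  by rewrite /inv_colsum /= !exprS; ring.
have body : \sum_(i < k.+2) inv_colsum (minn i.+1 m)
    = 2 + (-1) ^+ k * (fib k)%:Z.
  rewrite -sum_inv_colsum; apply: eq_bigr => i _; congr inv_colsum.
  by have := ltn_ord i; lia.
have -> : (-1) ^+ m = (-1) ^+ k :> int by rewrite mE !exprS; ring.
have [nE|nE] : n = k.+4 \/ n = k.+4.+1 by lia.
  rewrite nE !subSS subn0 big_ord_recr /= body.
  have := tail 0%N; rewrite addn0 => ->; rewrite fibSS; ring.
rewrite nE !subSS subn0 2!big_ord_recr /= body.
have := tail 0%N; rewrite addn0 => ->; have := tail 1%N; rewrite addn1 => ->.
rewrite [fib k.+3]fibSS fibSS; ring.
Qed.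

Lemma fib_le_fib2 k : (fib k <= fib2 k)%N.
Proof.
suff : (fib k <= fib2 k)%N && (fib k.+1 <= fib2 k.+1)%N by case/andP.
by elim: k => // k /andP[h1 h2]; rewrite h2 fibSS fib2SS /=; lia.
Qed.

(** In the recurrence for [fib2 k.+3], two terms are the last two of the sum, and
    [fib k.+1 <= fib2 k.+1] is bounded by the earlier hypothesis. *)
Lemma fib2_le_sum k : (fib2 k.+1 <= 1 + \sum_(i < k) fib2 i.+1)%N.
Proof.
suff : (fib2 k.+1 <= 1 + \sum_(i < k) fib2 i.+1)%N /\
       (fib2 k.+2 <= 1 + \sum_(i < k.+1) fib2 i.+1)%N by case.
elim: k => [|k [h1 h2]]; first by rewrite big_ord_recr big_ord0.
split=> //; rewrite 2!big_ord_recr /= [fib2 k.+3]fib2SS.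
by have := fib_le_fib2 k.+1; move: h1; set S := (\sum_(i < k) _)%N; lia.
Qed.

Lemma fib2_minn_le_sum m k :
  (fib2 (minn k.+1 m) <= 1 + \sum_(i < k) fib2 (minn i.+1 m))%N.
Proof.
have [km|mk] := leqP k.+1 m.
  rewrite (eq_bigr (fun i : 'I_k => fib2 i.+1)) ?fib2_le_sum // => i _.
  by rewrite (minn_idPl _) //; have := ltn_ord i; lia.
case: m mk => // m mk.
apply: leq_trans (fib2_le_sum m) _; rewrite leq_add2l.
rewrite (big_ord_widen k (fun i => fib2 i.+1)); last by lia.
rewrite big_mkcond; apply: leq_sum => i _; case: ifP => // im.
by rewrite (minn_idPl _) //; lia.
Qed.

(** Passing to [k + 1] adds 2 F_(k+3) on the left and at least as much, [fib2 k.+4], on the right.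
    The base case is the equality 6 = 1 + 1 + 1 + 3. *)
Lemma fib_le_sum_fib2 k :
  (2 * fib k.+4 <= 1 + \sum_(i < k.+3) fib2 i.+1)%N.
Proof.
have fib2_ge j : (2 * fib j.+2 <= fib2 j.+3)%N.
  suff : (2 * fib j.+2 <= fib2 j.+3)%N && (2 * fib j.+3 <= fib2 j.+4)%N.
    by case/andP.
  elim: j => // j /andP[h1 h2]; rewrite h2 /=.
  rewrite [fib j.+4]fibSS [fib2 j.+4.+1]fib2SS; lia.
elim: k => [|k IH]; first by rewrite !big_ord_recr big_ord0.
rewrite big_ord_recr /= [fib k.+4.+1]fibSS; have := fib2_ge k.+1; move: IH.
set S := (\sum_(i < k.+3) _)%N; lia.
Qed.

Lemma norm_inv_sq_colsum k : `|inv_sq_colsum k| = (fib2 k)%:Z.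
Proof.
rewrite /inv_sq_colsum; have [->//|_] := eqVneq k 1%N.
by rewrite normrM normrX normrN1 expr1n mul1r.
Qed.

(** * Realizing every integer of the interval *)

Lemma fib_mx_realizes (R : realType) n m (x0 x1 : nat -> bool) (s : int) :
  (6 <= n)%N -> (n - 3 <= m <= n - 2)%N ->
  \sum_(i < n.-1) (x0 i)%:R * inv_sq_colsum (minn i.+1 m)
    <= s - (2 + (-1) ^+ m * (fib (n - 2))%:Z)
    <= \sum_(i < n.-1) (x1 i)%:R * inv_sq_colsum (minn i.+1 m) ->
  exists A : 'M[R]_n,
    [/\ is_trig_mx A^T, A \notin unitmx, forall i j, A i j = 0 \/ A i j = 1
      & exists2 X : 'M[R]_n, is_group_inverse A X & entry_sum X = s%:~R].
Proof.
move=> n6 mP sP.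
have [|x xP] := subset_sum_between (z := fun i => inv_sq_colsum (minn i.+1 m))
  _ sP.
  move=> k; rewrite norm_inv_sq_colsum.
  rewrite (eq_bigr (fun i : 'I_k => (fib2 (minn i.+1 m))%:Z)); last first.
    by move=> i _; rewrite norm_inv_sq_colsum.
  rewrite -(big_morph Posz PoszD (erefl _)) -(PoszD 1) lez_nat.
  exact: fib2_minn_le_sum.
have m0 : (0 < m)%N by lia.
have [|||A [At Au A01 [X AX XE]]] := @bordered_realizes R n.-1 n
  (fib_mx R n.-1 m) (\col_i (x i)%:R) _ (fib_mx_unit R _ _) (fib_mx_trig R _ _).
- by rewrite addn1; lia.
- by move=> i j; rewrite mxE; case: (_ || _); [right | left].
- by move=> i; rewrite mxE; case: (x i); [right | left].
exists A; split => //; exists X => //.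
rewrite XE entry_sum_inv_fib_mx // entry_sum_inv_sq_fib_mx // -intrD.
by rewrite xP sum_inv_colsum_minn // addrC subrK.
Qed.

(** The sign of (-1)^m centres the even choice [mE] at 2 + F_(n-2) and the odd choice [mO] at 2 -
    F_(n-2). *)
Lemma fib_mx_realizes_interval (R : realType) n mE mO (x0 x1 : nat -> bool)
    (s : int) :
  (6 <= n)%N -> (n - 3 <= mE <= n - 2)%N -> (n - 3 <= mO <= n - 2)%N ->
  ~~ odd mE -> odd mO ->
  2 - (fib (n - 2))%:Z
      + \sum_(i < n.-1) (x0 i)%:R * inv_sq_colsum (minn i.+1 mO) <= s ->
  s <= 2 + (fib (n - 2))%:Z
      + \sum_(i < n.-1) (x1 i)%:R * inv_sq_colsum (minn i.+1 mE) ->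
  exists A : 'M[R]_n,
    [/\ is_trig_mx A^T, A \notin unitmx, forall i j, A i j = 0 \/ A i j = 1
      & exists2 X : 'M[R]_n, is_group_inverse A X & entry_sum X = s%:~R].
Proof.
move=> n6 mEP mOP oE oO s0 s1.
(* The inner endpoints: [y0] selects negative column sums and [y1] positive ones, only for
   [i < n - 3], where both matrices have the same column sums. *)
pose y0 i := [&& 0 < i, ~~ odd i & i < n - 3]%N.
pose y1 i := (((i == 0) || odd i) && (i < n - 3))%N.
pose lo := \sum_(i < n.-1) (y0 i)%:R * inv_sq_colsum (minn i.+1 mE).
pose hi := \sum_(i < n.-1) (y1 i)%:R * inv_sq_colsum (minn i.+1 mO).
have overlap : 2 * (fib (n - 2))%:Z <= 1 + hi - lo.
  have -> : 1 + hi - lo = (1 + \sum_(i < n - 3) fib2 i.+1)%N.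
    rewrite -addrA /hi /lo -sumrB PoszD (big_morph Posz PoszD (erefl _)).
    congr (_ + _); rewrite (big_ord_widen n.-1 (fun i => (fib2 i.+1)%:Z));
      last by lia.
    rewrite [RHS]big_mkcond; apply: eq_bigr => i _; rewrite /y0 /y1.
    have [i3|i3] := ltnP i (n - 3); last by rewrite !andbF !mul0r subr0.
    rewrite !andbT (minn_idPl _); last by lia.
    rewrite (minn_idPl _); last by lia.
    rewrite /inv_sq_colsum eqSS exprS -signr_odd.
    by case: (i : nat) => [|k] //=; case: (odd k); rewrite /=; ring.
  have [k nE] : exists k, n = k.+4.+2 by exists (n - 6)%N; lia.
  rewrite nE !subSS subn0; have := fib_le_sum_fib2 k.
  by set S := (\sum_(i < k.+3) _)%N; lia.
(* Below this threshold, integrality and [overlap] give [s <= 2 - F_(n-2) + hi], within reach of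
   [mO]. *)
have [sl|ls] := lerP (2 + (fib (n - 2))%:Z + lo) s.
- apply: (@fib_mx_realizes R n mE y0 x1) => //.
  rewrite -signr_odd (negbTE oE) mul1r -/lo; lia.
- apply: (@fib_mx_realizes R n mO x0 y1) => //.
  rewrite -signr_odd oO mulN1r -/hi; lia.
Qed.

Theorem theorem3p1 (R : realType) (n : nat) (s : int) :
  (6 <= n)%N ->
  (~~ odd n /\
     2 - (fib (n - 2))%:R - q_val R n <= s%:~R
       <= 2 + (fib (n - 2))%:R + p_val R n)
  \/
  (odd n /\
     2 - (fib (n - 2))%:R - s_val R n <= s%:~R
       <= 2 + (fib (n - 2))%:R + r_val R n) ->
  exists A : 'M[R]_n,
    [/\ is_trig_mx A^T (* [is_trig_mx] is lower triangularity *),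
        A \notin unitmx,
        forall i j, A i j = 0 \/ A i j = 1
      & exists2 X : 'M[R]_n, is_group_inverse A X & entry_sum X = s%:~R].
Proof.
move=> n6.
(* All bounds are images of integers, so the real inequalities descend to [int]. *)
have toZN (a : nat) (b : int) :
    2 - a%:R + b%:~R = (2 - a%:Z + b)%:~R :> R by rewrite !intrD mulrNz.
have toZP (a : nat) (b : int) :
    2 + a%:R + b%:~R = (2 + a%:Z + b)%:~R :> R by rewrite !intrD.
case=> -[on /andP[]].
- pose x0 i := ((0 < i) && ~~ odd i || (n - 3 <= i))%N.
  pose x1 i := [|| i == 0, odd i | i == n - 2]%N.
  rewrite /q_val /p_val opprK C1_fib_mx // C3_fib_mx // u_vecE // w_vecE //.
  rewrite (@entry_sum_inv_sq_fib_mx R _ _ x0); last by lia.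
  rewrite (@entry_sum_inv_sq_fib_mx R _ _ x1); last by lia.
  rewrite toZN toZP !ler_int.
  (* For even [n] the even choice is [n - 2]; for odd [n] the two choices swap. *)
  by apply: (@fib_mx_realizes_interval R n (n - 2) (n - 3) x0 x1) => //; lia.
- pose x0 i := ((0 < i) && ~~ odd i || (i == n - 2))%N.
  pose x1 i := [|| i == 0, odd i | n - 3 <= i]%N.
  rewrite /s_val /r_val opprK C2_fib_mx // C4_fib_mx // v_vecE // z_vecE //.
  rewrite (@entry_sum_inv_sq_fib_mx R _ _ x0); last by lia.
  rewrite (@entry_sum_inv_sq_fib_mx R _ _ x1); last by lia.
  rewrite toZN toZP !ler_int.
  by apply: (@fib_mx_realizes_interval R n (n - 3) (n - 2) x0 x1) => //; lia.
Qed.
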